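(* Let $\mathsf{N}$ be the $n\times n$ nilpotent matrix consisting of a single Jordan block, let $\mathsf{M}=\mathsf{N}^t$, and let $\nabla_{\mathsf{N}}$ and $\nabla_{\bar{\mathsf{M}}}$ be the operators on $\mathcal{P}^n$ defined in the context. Then in every degree $\ker\nabla_{\bar{\mathsf{M}}}$ is a complement to $\operatorname{im}\nabla_{\mathsf{N}}$, and $\ker\nabla_{\bar{\mathsf{M}}}$ consists exactly of the sums, over $k=1,\dots,n$ and $p=0,\dots,k-1$, of the maps $$\sum_{i+j=p}\frac{1}{i!\,j!}\,\frac{\binom{p}{i}}{\binom{n-1}{i}\binom{k-1}{j}}\;T^{p}_{k,j}(x)\;e_{n-i},$$ where the sum is over integers $i,j\ge 0$ with $i+j=p$, and where $$T^{p}_{k,j}(x)=x_{j+1}\,x_{n-k+j+1}\,F^{p}_{n-k+1}(x_{j+1},\dots,x_{n-k+j+1})\quad(1\le k\le n-1),\qquad T^{p}_{n,j}(x)=x_{j+1}\,F^{p}_{1}(x_{j+1}),$$ with $F^{p}_{n-k+1}$ an arbitrary formal power series in $n-k+1$ variables (one such series for each pair $(k,p)$). Thus adding the nonlinear maps of this form to $\mathsf{N}x$ gives the general normal form, in $\ker\nabla_{\bar{\mathsf{M}}}$-style, of maps with linear part $\mathsf{N}$.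
   Context: $P_k$ is the space of real homogeneous polynomials of degree $k$ in $x_1,\dots,x_n$; $\mathcal{P}^n_k=P_{k+1}\otimes\mathbb{R}^n$ for $k\ge 0$ and $\mathcal{P}^n=\prod_{k\ge0}\mathcal{P}^n_k$; $e_1,\dots,e_n$ is the standard basis of $\mathbb{R}^n$. The Jordan block is upper triangular: $\mathsf{N}e_1=0$, $\mathsf{N}e_j=e_{j-1}$ for $j\geq 2$. For a matrix $A$, $(A\varphi)(x)=A\varphi(x)$ and $(A_\star\varphi)(x)=\varphi(Ax)$ for $\varphi\in\mathcal{P}^n$; the homological operator is $\nabla_A=A-A_\star$. Define $$\bar{\mathsf{M}}=\sum_{i=1}^{n-1}\sum_{l=0}^{i-1}\mathsf{N}^{l}\mathsf{M}^{i}\mathsf{N}^{i-l-1},\qquad \bar{\mathsf{M}}_\star=\sum_{i=1}^{n-1}\sum_{l=0}^{i-1}(\mathsf{N}_\star)^{l}(\mathsf{M}_\star)^{i}(\mathsf{N}_\star)^{i-l-1},\qquad \nabla_{\bar{\mathsf{M}}}=\bar{\mathsf{M}}-\bar{\mathsf{M}}_\star$$ (here $\bar{\mathsf{M}}_\star$ is given by this formula, not by substitution of the matrix $\bar{\mathsf{M}}$). All these operators preserve each $\mathcal{P}^n_k$. A map $f=Ax+\sum_{k\ge1}f_k$, $f_k\in\mathcal{P}^n_k$, is in normal form with style $\mathcal{C}$ with respect to its linear part $A$ if $f_k\in\mathcal{C}_k$ for all $k\ge 1$, where $\mathcal{P}^n_k=\operatorname{im}\nabla_A\oplus\mathcal{C}_k$.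 *)

(* Defs.v *)
From HB Require Import structures.
From mathcomp Require Import all_boot all_order all_algebra.
From mathcomp Require Import reals.
From mathcomp.multinomials Require Import mpoly.
Set Implicit Arguments.
Unset Strict Implicit.
Unset Printing Implicit Defensive.
Import GRing.Theory.
Local Open Scope ring_scope.

(* The dimension is n = m.+1, since [dhomog n R d] is a vector space only for
   a successor n; thus the binomial coefficient n-1 over i is 'C(m, i). *)

Section Homogeneous.
Variable R : realType.

Lemma comp_dhomog (v n d : nat) (l : 'I_v -> dhomog n R 1) (p : dhomog v R d) :
  (val p \mPo [tuple val (l i) | i < v]) \is d.-homog.
Proof.
rewrite comp_mpolyEX rpred_sum // => mon _.
have [mon_p|] := boolP (mon \in msupp (val p)); last first.
  by move/memN_msupp_eq0 ->; rewrite scale0r rpred0.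
apply: rpredZ; rewrite comp_mpolyX.
have -> : d = (\sum_(i < v) mon i)%N.
  by rewrite -mdegE (dhomog_mf (valP p) mon_p).
elim/big_rec2: _ => [|i q e _ hq]; first exact: dhomog1.
apply: dhomogM => //; rewrite tnth_mktuple.
by have := dhomogMn (mon i) (valP (l i)); rewrite mul1n.
Qed.

(* p(l_1(x), ..., l_v(x)) for linear forms l_1, ..., l_v *)
Definition hcomp (v n d : nat) (l : 'I_v -> dhomog n R 1) (p : dhomog v R d) :
  dhomog n R d := DHomog (comp_dhomog l p).

Lemma hcomp_is_linear (v n d : nat) (l : 'I_v -> dhomog n R 1) :
  linear (@hcomp v n d l).
Proof. by move=> c p q; apply/val_inj; rewrite /= !linearP. Qed.

Lemma dhomogX1 (n : nat) (i : 'I_n) : ('X_i : {mpoly R[n]}) \is 1.-homog.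
Proof. by rewrite dhomogX /= mdeg1. Qed.

Definition hvar (n : nat) (i : 'I_n) : dhomog n R 1 := DHomog (dhomogX1 i).

Lemma dhomogM1 (n d : nat) (l : dhomog n R 1) (p : dhomog n R d) :
  (val l * val p) \is d.+1.-homog.
Proof. by apply: (@dhomogM _ _ _ 1%N) => //; apply/dhomog_is_dhomog. Qed.

(* A formal power series is the sequence of its homogeneous components. *)
Definition fps (v : nat) := forall d : nat, dhomog v R d.

Definition fps_comp (v n : nat) (l : 'I_v -> dhomog n R 1) (F : fps v) :
  fps n := fun d => hcomp l (F d).

Definition fps_lmul (n : nat) (l : dhomog n R 1) (F : fps n) : fps n :=
  fun d => match d with 0 => 0 | d'.+1 => DHomog (dhomogM1 l (F d')) end.

End Homogeneous.

Notation "''P^' n [ R ]_ k" := {ffun 'I_n -> dhomog n R k.+1}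
  (at level 8, n at level 2, k at level 2, format "''P^' n [ R ]_ k").

(* The product of all the 'P^n[R]_k; equality is stated degree by degree. *)
Definition formal_map (R : realType) (m : nat) := forall k : nat, 'P^m.+1[R]_k.

Section Operators.
Variables (R : realType) (m : nat).
Local Notation n := m.+1.

Definition linear_form (A : 'M[R]_n) (i : 'I_n) : dhomog n R 1 :=
  \sum_j A i j *: hvar R j.

(* The map x |-> A x, which is of degree 1 and so has index 0. *)
Definition linear_part (A : 'M[R]_n) : formal_map R m :=
  fun k => match k with 0 => [ffun i => linear_form A i] | _ => 0 end.

Definition act_fun (k : nat) (A : 'M[R]_n) (phi : 'P^n[R]_k) : 'P^n[R]_k :=
  [ffun i => \sum_j A i j *: phi j].

Definition star_fun (k : nat) (A : 'M[R]_n) (phi : 'P^n[R]_k) : 'P^n[R]_k :=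
  [ffun i => hcomp (linear_form A) (phi i)].

Lemma act_fun_is_linear k A : linear (@act_fun k A).
Proof.
move=> c f g; apply/ffunP => i; rewrite !ffunE scaler_sumr -big_split /=.
by apply: eq_bigr => j _; rewrite !ffunE scalerDr !scalerA mulrC.
Qed.

Lemma star_fun_is_linear k A : linear (@star_fun k A).
Proof. by move=> c f g; apply/ffunP => i; rewrite !ffunE hcomp_is_linear. Qed.

HB.instance Definition _ k A :=
  GRing.isLinear.Build R 'P^n[R]_k 'P^n[R]_k _ (@act_fun k A)
    (@act_fun_is_linear k A).
HB.instance Definition _ k A :=
  GRing.isLinear.Build R 'P^n[R]_k 'P^n[R]_k _ (@star_fun k A)
    (@star_fun_is_linear k A).

Definition act (k : nat) (A : 'M[R]_n) : 'End('P^n[R]_k) :=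
  linfun (@act_fun k A).
Definition star (k : nat) (A : 'M[R]_n) : 'End('P^n[R]_k) :=
  linfun (@star_fun k A).

Definition nabla (k : nat) (A : 'M[R]_n) : 'End('P^n[R]_k) :=
  act k A - star k A.

Definition jordanN : 'M[R]_n := \matrix_(i, j) (j == i.+1 :> nat)%:R.
Definition jordanM : 'M[R]_n := jordanN^T.

Definition Mbar : 'M[R]_n :=
  \sum_(1 <= i < n) \sum_(0 <= l < i)
    jordanN ^+ l * jordanM ^+ i * jordanN ^+ (i - l - 1).

Definition lfun_pow (vT : vectType R) (f : 'End(vT)) (l : nat) : 'End(vT) :=
  iter l (comp_lfun f) \1%VF.

(* This is not [star k Mbar], since A |-> star k A is not additive. *)
Definition Mbar_star (k : nat) : 'End('P^n[R]_k) :=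
  \sum_(1 <= i < n) \sum_(0 <= l < i)
    (lfun_pow (star k jordanN) l \o lfun_pow (star k jordanM) i
       \o lfun_pow (star k jordanN) (i - l - 1))%VF.

Definition nabla_Mbar (k : nat) : 'End('P^n[R]_k) := act k Mbar - Mbar_star k.

Definition complement (vT : vectType R) (U V : {vspace vT}) : Prop :=
  (U + V = fullv)%VS /\ (U :&: V = 0)%VS.

Definition normal_form (A : 'M[R]_n) (C : forall k : nat, {vspace 'P^n[R]_k})
    (f : formal_map R m) : Prop :=
  f 0%N = linear_part A 0%N /\
  forall k : nat, (1 <= k)%N ->
    complement (limg (nabla k A)) (C k) /\ f k \in C k.

End Operators.

Section KernelForm.
Variables (R : realType) (m : nat).
Local Notation n := m.+1.

(* The variable x_i, with i counted from 1 (only used for 1 <= i <= n). *)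
Definition xvar (i : nat) : dhomog n R 1 := hvar R (inord i.-1).

(* The vector field g(x) e_r, with r counted from 1 (only used for
   1 <= r <= n and g(0) = 0). *)
Definition fps_vec (g : fps R n) (r : nat) : formal_map R m :=
  fun k => [ffun i : 'I_n => if i.+1 == r then g k.+1 else 0].

Definition Tseries (k j : nat) (F : fps R (n - k).+1) : fps R n :=
  let G := fps_comp (fun v : 'I_(n - k).+1 => xvar (j.+1 + v)) F in
  if k == n then fps_lmul (xvar j.+1) G
  else fps_lmul (xvar j.+1) (fps_lmul (xvar (n - k + j.+1)) G).

Definition Tcoef (k p i j : nat) : R :=
  1 / (i`! * j`!)%:R * ('C(p, i)%:R / ('C(m, i) * 'C(k.-1, j))%:R).

(* The sum over 1 <= k <= n and 0 <= p <= k - 1; the series is [F k p], whose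
   values for other k, p are irrelevant. *)
Definition kernel_form (F : forall k p : nat, fps R (n - k).+1) :
  formal_map R m := fun d =>
  \sum_(1 <= k < n.+1) \sum_(0 <= p < k) \sum_(i < p.+1)
    Tcoef k p i (p - i) *:
      fps_vec (Tseries (p - i) (F k p)) (n - i) d.

End KernelForm.

(* Main.v *)
(* On R^n the operators N and Mbar lower and raise by one step, with
   Mbar e_j = j (n - j) e_{j+1}, and on polynomials N_* and M_* shift all the
   indices of the variables up and down by one. So the monomials fall into
   shift chains of length k, where n - k + 1 is the width of the support, and the
   j-th element u_j (counted from 0) satisfies Mbar_* u_j = j (k - j) u_{j-1};
   the functions T^p_{k,j}, j = 0, ..., k - 1, are such a chain. Comparing
   coefficients of e_i, ker nabla_Mbar is given by a two-term recurrence, which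
   shows that an element is determined by its last component, and that the maps
   of the theorem belong to the kernel.  Their last components sum_p T^p_{k,p}
   exhaust all polynomials, since a monomial with lowest variable x_{p+1} and
   width n - k + 1 is of the form T^p_{k,p}; so these maps are the whole kernel.
   Finally im nabla_N is the kernel of phi |-> sum_i N_*^{n-i} phi_i, and this
   map sends the kernel element built from T^p_{k,.} to a positive multiple of
   T^p_{k,p}; hence it is onto already on ker nabla_Mbar, whose dimension is at
   most that of the target, and the two subspaces are complementary. *)
Require Import Defs.
From HB Require Import structures.
From mathcomp Require Import all_boot all_order all_algebra.
From mathcomp Require Import boolp reals.
From mathcomp.multinomials Require Import mpoly.
From mathcomp Require Import zify ring.
Set Implicit Arguments.
Unset Strict Implicit.
Unset Printing Implicit Defensive.
Import Order.TTheory GRing.Theory Num.Theory.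
Local Open Scope ring_scope.

(** * Iterates of additive maps and a counting identity *)

Lemma iter_fixed0 (V : zmodType) (f : V -> V) t : f 0 = 0 -> iter t f 0 = 0.
Proof. by move=> f0; elim: t => //= t ->. Qed.

Lemma iter_linear (R : pzRingType) (V : lmodType R) (f : V -> V) t :
  linear f -> linear (iter t f).
Proof. by move=> fL; elim: t => [|t IH] c u v //=; rewrite IH fL. Qed.

Lemma iter_raddfB (V : zmodType) (f : {additive V -> V}) t (x y : V) :
  iter t f (x - y) = iter t f x - iter t f y.
Proof. by elim: t => [|t IH] //=; rewrite IH raddfB. Qed.

Lemma iter_raddf_sum (V : zmodType) (f : {additive V -> V}) t I (r : seq I)
    (P : pred I) (F : I -> V) :
  iter t f (\sum_(i <- r | P i) F i) = \sum_(i <- r | P i) iter t f (F i).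
Proof. by elim: t => [|t IH] //=; rewrite IH raddf_sum. Qed.

(** With [c' = i - l - 1] the pairs [(i, l)] become pairs [(l, c')]; each pair with [l < j] and
    [c' < c] occurs once, because then [i = l + c' + 1 < j + c <= n]. *)
Lemma count_box (n j c : nat) : (j + c <= n)%N ->
  (\sum_(1 <= i < n) \sum_(0 <= l < i) ((l < j) && (i - l - 1 < c)) = j * c)%N.
Proof.
case: n => [|n] jc.
  by rewrite big_geq //; move: jc; case: j.
rewrite big_add1 /= big_mkord.
transitivity (\sum_(i < n) \sum_(l < n)
    ((l <= i) && ((l < j) && (i - l < c))))%N.
  apply: eq_bigr => i _.
  rewrite big_mkord (big_ord_widen n (fun l : nat =>
    ((l < j)%N && (i.+1 - l - 1 < c)%N : nat)) (ltn_ord i)) big_mkcond /=.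
  apply: eq_bigr => l _; rewrite ltnS.
  by case: (leqP l i) => //= li; rewrite subSn // subn1.
rewrite exchange_big /=.
case: (posnP c) => [->|c0].
  by rewrite muln0 big1 // => l _; rewrite big1 // => i _; rewrite ltn0 !andbF.
have jn : (j <= n)%N by lia.
transitivity (\sum_(l < j) c)%N; last by rewrite sum_nat_const card_ord.
rewrite (big_ord_widen n (fun=> c) jn) [RHS]big_mkcond /=.
apply: eq_bigr => l _; case: ltnP => lj; last first.
  by rewrite big1 // => i _; rewrite andbF.
(* For fixed [l < j] the admissible [i], by now lowered by one, fill the interval from [l] to
   [l + c - 1]. *)
transitivity (\sum_(l <= i < l + c) 1)%N; last by rewrite sum_nat_const_nat; lia.
rewrite -(big_mkord xpredT (fun i : nat => ((l <= i) && (true && (i - l < c)))%N : nat)).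
rewrite (big_cat_nat (n := l)) //=; last by lia.
rewrite (big_cat_nat (n := l + c) (m := l)) /= ?leq_addr //; last by lia.
rewrite big_nat big1 ?add0n; last by move=> i /andP[_ il]; rewrite leqNgt il.
rewrite addnC big_nat big1 ?add0n; last by move=> i /andP[ci _]; lia.
by rewrite big_nat [RHS]big_nat; apply: eq_bigr => i /andP[li ic]; lia.
Qed.

(** * Powers of the two step operators along a Jordan chain *)

Section Chain.
Variables (V : zmodType) (a b : V -> V) (k : nat) (u : nat -> V).
Hypotheses (a0 : a 0 = 0) (b0 : b 0 = 0).
Hypothesis ha : forall j, (j < k)%N -> a (u j) = if (j.+1 < k)%N then u j.+1 else 0.
Hypothesis hb : forall j, (j < k)%N -> b (u j) = if j is j'.+1 then u j' else 0.

Lemma chain_iter_up t j : (j < k)%N ->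
  iter t a (u j) = if (j + t < k)%N then u (j + t) else 0.
Proof.
move=> jk; elim: t => [|t IH]; first by rewrite addn0 jk.
rewrite iterS IH addnS; case: (ltnP (j + t) k) => [h|h]; first by rewrite ha.
by rewrite a0 ltnNge (leq_trans h) // leqnSn.
Qed.

Lemma chain_iter_down t j : (j < k)%N ->
  iter t b (u j) = if (t <= j)%N then u (j - t) else 0.
Proof.
move=> jk; elim: t => [|t IH]; first by rewrite subn0.
rewrite iterS IH; case: (leqP t j) => h; last first.
  by rewrite b0; have -> : (t < j)%N = false by lia.
rewrite hb; last by lia.
case E: (j - t)%N => [|s]; first by have -> : (t.+1 <= j)%N = false by lia.
have -> : (t.+1 <= j)%N by lia.
by congr u; lia.
Qed.

(* This is the sl_2 raising operator of a Jordan chain of length k; the bound n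
   on the summation is irrelevant as soon as k <= n. *)
Lemma chain_raising n j : (k <= n)%N -> (j < k)%N ->
  \sum_(1 <= i < n) \sum_(0 <= l < i)
     iter l a (iter i b (iter (i - l - 1) a (u j))) =
  u j.-1 *+ (j * (k - j)).
Proof.
move=> kn jk; rewrite -(@count_box n) ?subnKC //; last by lia.
rewrite -sumrMnr big_nat [RHS]big_nat; apply: eq_bigr => i /andP[i0 _].
rewrite -sumrMnr big_nat [RHS]big_nat; apply: eq_bigr => l /andP[_ li].
rewrite chain_iter_up //.
have -> : (i - l - 1 < k - j)%N = (j + (i - l - 1) < k)%N by lia.
case: ifP => h; last by rewrite andbF !iter_fixed0.
rewrite andbT chain_iter_down //.
have -> : (i <= j + (i - l - 1))%N = (l < j)%N by lia.
case: ifP => lj; last by rewrite iter_fixed0.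
rewrite chain_iter_up; last by lia.
have -> : (j + (i - l - 1) - i + l)%N = j.-1 by lia.
by rewrite ifT //; lia.
Qed.

End Chain.

(** * Substitution of linear forms *)

HB.instance Definition _ (R : realType) (v n d : nat) l :=
  GRing.isLinear.Build R (dhomog v R d) (dhomog n R d) _ (@hcomp R v n d l)
    (@hcomp_is_linear R v n d l).

Section Substitution.
Variable R : realType.

Lemma hcomp_ext v n d (l l' : 'I_v -> dhomog n R 1) (p : dhomog v R d) :
  l =1 l' -> hcomp l p = hcomp l' p.
Proof.
move=> ll'; apply/val_inj; rewrite /=; congr comp_mpoly.
by apply: eq_from_tnth => i; rewrite !tnth_mktuple ll'.
Qed.

Lemma hcomp_comp v n s d (l : 'I_n -> dhomog s R 1) (l' : 'I_v -> dhomog n R 1)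
    (p : dhomog v R d) :
  hcomp l (hcomp l' p) = hcomp (fun i => hcomp l (l' i)) p.
Proof.
apply/val_inj; rewrite /= [RHS]comp_mpolyEX.
rewrite (comp_mpolyEX (mpoly_of_dhomog p)) raddf_sum /=.
apply: eq_bigr => mon _; rewrite !linearZ /=; congr (_ *: _).
rewrite !comp_mpolyX rmorph_prod; apply: eq_bigr => i _.
by rewrite rmorphXn /= !tnth_mktuple.
Qed.

Lemma hcomp_hvar v n (l : 'I_v -> dhomog n R 1) i : hcomp l (hvar R i) = l i.
Proof. by apply/val_inj; rewrite /= comp_mpolyXU -tnth_nth tnth_mktuple. Qed.

Lemma fps_lmul_ext n (x y : dhomog n R 1) (F G : fps R n) d :
  x = y -> (forall e, F e = G e) -> fps_lmul x F d = fps_lmul y G d.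
Proof. by move=> -> FG; case: d => //= d; apply/val_inj; rewrite /= FG. Qed.

Lemma fps_lmul0l n (F : fps R n) d : fps_lmul 0 F d = 0.
Proof. by case: d => //= d; apply/val_inj; rewrite /= mul0r. Qed.

Lemma fps_lmul0r n (x : dhomog n R 1) (F : fps R n) d :
  (forall e, F e = 0) -> fps_lmul x F d = 0.
Proof. by move=> F0; case: d => //= d; apply/val_inj; rewrite /= F0 mulr0. Qed.

Lemma hcomp_lmul v n (l : 'I_v -> dhomog n R 1) x (F : fps R v) d :
  hcomp l (fps_lmul x F d) = fps_lmul (hcomp l x) (fps_comp l F) d.
Proof.
case: d => [|d]; first by rewrite /= linear0.
by apply/val_inj; rewrite /= rmorphM.
Qed.

End Substitution.

(** * Index shifts of the variables, and the operators [Mbar] and [Mbar_star] *)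

Section Shifts.
Variables (R : realType) (m : nat).
Local Notation n := m.+1.

(** This is N_* on one component: the i-th coordinate of Nx is x_{i+1}, so indices go up. Likewise
    [shift_down] is M_*. *)
Definition shift_up d : dhomog n R d -> dhomog n R d :=
  hcomp (linear_form (jordanN R m)).
Definition shift_down d : dhomog n R d -> dhomog n R d :=
  hcomp (linear_form (jordanM R m)).

HB.instance Definition _ d := GRing.Linear.on (@shift_up d).
HB.instance Definition _ d := GRing.Linear.on (@shift_down d).

Lemma shift_up_xvar i : (0 < i <= n)%N ->
  shift_up (xvar R m i) = if (i < n)%N then xvar R m i.+1 else 0.
Proof.
move=> /andP[i0 le_in]; rewrite /shift_up hcomp_hvar /linear_form.
have E (j : 'I_n) : jordanN R m (inord i.-1) j = (j == i :> nat)%:R.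
  by rewrite mxE inordK ?prednK.
case: ltnP => [lt_in|le_ni].
  rewrite (bigD1 (inord i)) //= big1 => [|j].
    by rewrite E inordK // eqxx scale1r addr0.
  by rewrite E -val_eqE /= inordK // => /negbTE ->; rewrite scale0r.
rewrite big1 // => j _; rewrite E ltn_eqF ?scale0r //.
exact: leq_trans (ltn_ord j) le_ni.
Qed.

Lemma shift_down_xvar i : (0 < i <= n)%N ->
  shift_down (xvar R m i) = if (1 < i)%N then xvar R m i.-1 else 0.
Proof.
move=> /andP[i0 le_in]; rewrite /shift_down hcomp_hvar /linear_form.
have E (j : 'I_n) : jordanM R m (inord i.-1) j = (i.-1 == j.+1 :> nat)%:R.
  by rewrite !mxE inordK ?prednK.
case: ltnP => [i1|i1]; last first.
  rewrite big1 // => j _; rewrite E.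
  by case: i i0 i1 {le_in E} => [|[]] //; rewrite scale0r.
have ltn : (i.-2 < n)%N by lia.
rewrite (bigD1 (inord i.-2)) //= big1 => [|j].
  by rewrite E inordK // prednK ?eqxx ?scale1r ?addr0 //; lia.
rewrite E -val_eqE /= inordK // => h; have -> : (i.-1 == j.+1) = false by lia.
by rewrite scale0r.
Qed.

(** The top variable of the window, x_{n-k+j+1}, is a factor: for j = k - 1 it is x_n and the shift
    kills the product; for smaller j no variable is lost. For k = n the single factor x_{j+1} is
    also the top variable. *)
Lemma shift_up_Tseries k j (F : fps R (n - k).+1) d :
  (0 < k <= n)%N -> (j < k)%N ->
  shift_up (Tseries j F d) = if (j.+1 < k)%N then Tseries j.+1 F d else 0.
Proof.
move=> /andP[k0 kn] jk; rewrite /Tseries.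
have HG e : (j.+1 < k)%N ->
    shift_up (fps_comp (fun v : 'I_(n - k).+1 => xvar R m (j.+1 + v)) F e) =
    fps_comp (fun v : 'I_(n - k).+1 => xvar R m (j.+2 + v)) F e.
  move=> jk1; rewrite /shift_up hcomp_comp; apply: hcomp_ext => v.
  have := ltn_ord v; rewrite ltnS => hv.
  by rewrite -/(shift_up _) shift_up_xvar ?ifT //; lia.
rewrite /shift_up; case: eqP => [ekn|nekn].
  rewrite hcomp_lmul -/(shift_up _) shift_up_xvar; last by lia.
  rewrite -{3}ekn; case: ifP => jk1; last by rewrite fps_lmul0l.
  by apply: fps_lmul_ext => // e; apply: HG.
rewrite hcomp_lmul -/(shift_up _) shift_up_xvar; last by lia.
rewrite ifT; last by lia.
case: ifP => jk1; last first.
  apply: fps_lmul0r => e; rewrite /fps_comp hcomp_lmul.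
  rewrite -/(shift_up _) shift_up_xvar; last by lia.
  by rewrite ifF ?fps_lmul0l //; lia.
apply: fps_lmul_ext => // e; rewrite /fps_comp hcomp_lmul.
apply: fps_lmul_ext => [|e']; last exact: HG.
rewrite -/(shift_up _) shift_up_xvar; last by lia.
by rewrite ifT ?addnS //; lia.
Qed.

(** Here the factor x_{j+1} ends the chain: at j = 0 it is x_1. *)
Lemma shift_down_Tseries k j (F : fps R (n - k).+1) d :
  (0 < k <= n)%N -> (j < k)%N ->
  shift_down (Tseries j F d) = if j is j'.+1 then Tseries j' F d else 0.
Proof.
move=> /andP[k0 kn] jk; rewrite /Tseries.
case: j jk => [|j] jk; rewrite /shift_down.
  by case: ifP => _; rewrite hcomp_lmul -/(shift_down _) shift_down_xvar ?fps_lmul0l.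
have HG e :
    shift_down (fps_comp (fun v : 'I_(n - k).+1 => xvar R m (j.+2 + v)) F e) =
    fps_comp (fun v : 'I_(n - k).+1 => xvar R m (j.+1 + v)) F e.
  rewrite /shift_down hcomp_comp; apply: hcomp_ext => v.
  have := ltn_ord v; rewrite ltnS => hv.
  by rewrite -/(shift_down _) shift_down_xvar ?ifT //; lia.
case: eqP => [ekn|nekn].
  rewrite hcomp_lmul -/(shift_down _) shift_down_xvar; last by lia.
  by apply: fps_lmul_ext => // e; apply: HG.
rewrite hcomp_lmul -/(shift_down _) shift_down_xvar; last by lia.
apply: fps_lmul_ext => // e; rewrite /fps_comp hcomp_lmul.
apply: fps_lmul_ext => [|e']; last exact: HG.
rewrite -/(shift_down _) shift_down_xvar; last by lia.
by rewrite ifT ?addnS //; lia.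
Qed.

(** This is [Mbar_star] on one component, written with plain iterates so that [chain_raising]
    applies. *)
Definition raising d (q : dhomog n R d) : dhomog n R d :=
  \sum_(1 <= i < n) \sum_(0 <= l < i)
    iter l (@shift_up d)
      (iter i (@shift_down d) (iter (i - l - 1) (@shift_up d) q)).

Lemma raising_is_linear d : linear (@raising d).
Proof.
move=> c p q; rewrite /raising scaler_sumr -big_split /=; apply: eq_bigr => i _.
rewrite scaler_sumr -big_split /=; apply: eq_bigr => l _.
by do 3 (rewrite iter_linear; last exact: linearP).
Qed.

HB.instance Definition _ d :=
  GRing.isLinear.Build R (dhomog n R d) (dhomog n R d) _ (@raising d)
    (@raising_is_linear d).

Lemma raising_Tseries k j (F : fps R (n - k).+1) d :
  (0 < k <= n)%N -> (j < k)%N ->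
  raising (Tseries j F d) = Tseries j.-1 F d *+ (j * (k - j)).
Proof.
move=> kn jk.
apply: (@chain_raising _ (@shift_up d) (@shift_down d) k
  (fun j => Tseries j F d)) => //.
- exact: linear0.
- exact: linear0.
- by move=> i ik; apply: shift_up_Tseries.
- by move=> i ik; apply: shift_down_Tseries.
- by case/andP: kn.
Qed.

Lemma iter_shift_up_Tseries k j t (F : fps R (n - k).+1) d :
  (0 < k <= n)%N -> (j + t < k)%N ->
  iter t (@shift_up d) (Tseries j F d) = Tseries (j + t) F d.
Proof.
move=> kn jtk.
rewrite (@chain_iter_up _ (@shift_up d) k (fun j => Tseries j F d)) ?jtk //.
- exact: linear0.
- by move=> i ik; apply: shift_up_Tseries.
- by lia.
Qed.

(** The vectors e_n, ..., e_1 form a chain of length n for N, with M stepping back, so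
    [chain_raising] computes [Mbar] as well. *)
Lemma Mbar_entry (i j : 'I_n) :
  Mbar R m i j = ((i == j.+1 :> nat) * (i * (n - i)))%N%:R.
Proof.
pose e (r : nat) : 'cV[R]_n := delta_mx (inord (m - r)) 0.
pose a (v : 'cV[R]_n) := jordanN R m *m v.
pose b (v : 'cV[R]_n) := jordanM R m *m v.
have col A r s : (A *m (e r)) s 0 = A s (inord (m - r)) :> R.
  rewrite mxE (bigD1 (inord (m - r))) //= big1 => [|t /negbTE tr].
    by rewrite mxE !eqxx mulr1 addr0.
  by rewrite mxE tr mulr0.
have ha r : (r < n)%N -> a (e r) = if (r.+1 < n)%N then e r.+1 else 0.
  move=> rn; apply/matrixP => s t; rewrite [t]ord1 col mxE inordK; last by lia.
  case: ifP => rn1; rewrite !mxE -?val_eqE /= ?inordK; try by lia.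
    by congr (_%:R); have := ltn_ord s; lia.
  by have -> : (m - r)%N == s.+1 = false by lia.
have hb r : (r < n)%N -> b (e r) = if r is r'.+1 then e r' else 0.
  move=> rn; apply/matrixP => s t; rewrite [t]ord1 col !mxE inordK; last by lia.
  case: r rn => [|r] rn; rewrite !mxE -?val_eqE /= ?inordK; try by lia.
    by have -> : s == (m - 0).+1 :> nat = false by have := ltn_ord s; lia.
  by congr (_%:R); have := ltn_ord s; lia.
have iterE (A : 'M[R]_n) t v : A ^+ t *m v = iter t (mulmx A) v.
  elim: t v => [|t IH] v; first by rewrite expr0 mul1mx.
  by rewrite exprS /= -IH mulmxA.
have chain := @chain_raising _ a b n e (mulmx0 _ _) (mulmx0 _ _) ha hb n (m - j)%N
  (leqnn n).
have -> : Mbar R m i j = (Mbar R m *m e (m - j)%N) i 0.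
  rewrite col subKn; last by rewrite -ltnS.
  by rewrite inord_val.
rewrite /Mbar mulmx_suml.
under eq_bigr => t _.
  rewrite mulmx_suml.
  under eq_bigr => l _ do rewrite -!mulmxA !iterE.
  over.
rewrite chain ?ltnS ?leq_subr // -scaler_nat !mxE -val_eqE /= inordK; last by lia.
have := ltn_ord i; have := ltn_ord j => hj hi.
rewrite andbT -natrM; congr (_%:R); nia.
Qed.

End Shifts.

(** * The kernel equations and their explicit solutions *)

Section Kernel.
Variables (R : realType) (m : nat).
Local Notation n := m.+1.

Lemma nabla_jordanNE k (phi : 'P^n[R]_k) (i : 'I_n) :
  nabla k (jordanN R m) phi i =
  (if (i.+1 < n)%N then phi (inord i.+1) else 0) - shift_up (phi i).
Proof.
rewrite /nabla /act /star add_lfunE opp_lfunE !lfunE /= !ffunE; congr (_ - _).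
case: ifP => h.
  rewrite (bigD1 (inord i.+1)) //= big1 => [|j].
    by rewrite mxE inordK // eqxx scale1r addr0.
  rewrite -val_eqE /= inordK // => ji.
  by rewrite mxE (negbTE ji) scale0r.
rewrite big1 // => j _; rewrite mxE.
have -> : j == i.+1 :> nat = false by have := ltn_ord j; lia.
by rewrite scale0r.
Qed.

Lemma Mbar_starE k (phi : 'P^n[R]_k) (i : 'I_n) :
  Mbar_star R m k phi i = raising (phi i).
Proof.
have pow A l (psi : 'P^n[R]_k) :
    lfun_pow (star k A) l psi i = iter l (hcomp (linear_form A)) (psi i).
  by elim: l => [|l IH] /=; rewrite ?id_lfunE // comp_lfunE lfunE /= ffunE IH.
rewrite /Mbar_star /raising sum_lfunE sum_ffunE; apply: eq_bigr => s _.
rewrite sum_lfunE sum_ffunE; apply: eq_bigr => l _.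
by rewrite !comp_lfunE !pow.
Qed.

(** Row [i] of [Mbar] vanishes outside column [i - 1], so each equation links two components; at
    [i = 0] the factor is zero, which makes [i.-1] harmless. *)
Lemma mem_lker_nabla_Mbar k (phi : 'P^n[R]_k) :
  phi \in lker (nabla_Mbar R m k) <->
  forall i : 'I_n, phi (inord i.-1) *+ (i * (n - i)) = raising (phi i).
Proof.
have E (i : 'I_n) :
    nabla_Mbar R m k phi i = phi (inord i.-1) *+ (i * (n - i)) - raising (phi i).
  rewrite /nabla_Mbar add_lfunE opp_lfunE !ffunE Mbar_starE.
  congr (_ - _); rewrite /act lfunE /= ffunE.
  rewrite (bigD1 (inord i.-1)) //= big1 => [|j].
    rewrite Mbar_entry inordK; last by have := ltn_ord i; lia.
    rewrite addr0 scaler_nat; congr (_ *+ _).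
    by have := ltn_ord i; nia.
  rewrite -val_eqE /= inordK; last by have := ltn_ord i; lia.
  move=> ji; rewrite Mbar_entry.
  have -> : i == j.+1 :> nat = false by lia.
  by rewrite scale0r.
rewrite memv_ker; split=> [/eqP h i|h].
  by apply/eqP; rewrite -subr_eq0 -E h ffunE.
by apply/eqP/ffunP => i; rewrite E h subrr ffunE.
Qed.

(** This is the coefficient of e_{n-r} in the kernel equation of the map attached to (k, p); it
    follows from the absorption identity for each of the three binomials. *)
Lemma Tcoef_rec k p r : (k <= n)%N -> (p < k)%N -> (r < p)%N ->
  Tcoef R m k p r.+1 (p - r.+1) *+ ((m - r) * r.+1) =
  Tcoef R m k p r (p - r) *+ ((p - r) * (k - (p - r))).
Proof.
move=> kn pk rp; rewrite /Tcoef.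
have [j Ej] : exists j, (p - r = j.+1)%N by exists (p - r).-1; lia.
have -> : (p - r.+1 = j)%N by lia.
rewrite Ej.
have hp : ('C(p, r.+1) * r.+1 = j.+1 * 'C(p, r))%N by rewrite mulnC mul_bin_left Ej.
have hm : (r.+1 * 'C(m, r.+1) = (m - r) * 'C(m, r))%N by rewrite mul_bin_left.
have hk : (j.+1 * 'C(k.-1, j.+1) = (k - j.+1) * 'C(k.-1, j))%N.
  by rewrite mul_bin_left; congr (_ * _)%N; lia.
have nz a : (0 < a)%N -> a%:R != 0 :> R by rewrite pnatr_eq0 -lt0n.
have m0 : (0 < m - r)%N by lia.
have k0 : (0 < k - j.+1)%N by lia.
have b1 : 'C(m, r)%:R != 0 :> R by apply: nz; rewrite bin_gt0; lia.
have b2 : 'C(k.-1, j)%:R != 0 :> R by apply: nz; rewrite bin_gt0; lia.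
have b3 : 'C(m, r.+1)%:R != 0 :> R by apply: nz; rewrite bin_gt0; lia.
have b4 : 'C(k.-1, j.+1)%:R != 0 :> R by apply: nz; rewrite bin_gt0; lia.
have r1 : r.+1%:R != 0 :> R by apply: nz.
have j1 : j.+1%:R != 0 :> R by apply: nz.
have mr : (m - r)%:R != 0 :> R by apply: nz.
have kj : (k - j.+1)%:R != 0 :> R by apply: nz.
have fr : (r`!)%:R != 0 :> R by apply: nz; apply: fact_gt0.
have fj : (j`!)%:R != 0 :> R by apply: nz; apply: fact_gt0.
rewrite !factS -[LHS]mulr_natr -[RHS]mulr_natr !natrM.
(* All binomials are brought to the lower indices [r] and [j], which leaves a rational identity in
   independent unknowns. *)
have -> : 'C(p, r.+1)%:R = j.+1%:R * 'C(p, r)%:R / r.+1%:R :> R.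
  by rewrite -natrM -hp natrM mulfK.
have -> : 'C(m, r.+1)%:R = (m - r)%:R * 'C(m, r)%:R / r.+1%:R :> R.
  by rewrite -natrM -hm natrM mulrC mulKf.
have -> : 'C(k.-1, j.+1)%:R = (k - j.+1)%:R * 'C(k.-1, j)%:R / j.+1%:R :> R.
  by rewrite -natrM -hk natrM mulrC mulKf.
move: b1 b2 r1 j1 mr kj fr fj.
move: ('C(p, r)%:R : R) ('C(m, r)%:R : R) ('C(k.-1, j)%:R : R) (r.+1%:R : R)
  (j.+1%:R : R) ((m - r)%:R : R) ((k - j.+1)%:R : R) (r`!%:R : R) (j`!%:R : R).
move=> A B C r' j' M K fr fj *; field.
by do ![apply/andP; split].
Qed.

Definition kernel_term k p (F : fps R (n - k).+1) : formal_map R m := fun d =>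
  \sum_(i < p.+1) Tcoef R m k p i (p - i) *: fps_vec (Tseries (p - i) F) (n - i) d.

Lemma kernel_termE k p (F : fps R (n - k).+1) d (i : 'I_n) : (p < k <= n)%N ->
  kernel_term p F d i =
  if (m - i <= p)%N
  then Tcoef R m k p (m - i) (p - (m - i)) *: Tseries (p - (m - i)) F d.+1 else 0.
Proof.
move=> pkn; rewrite /kernel_term sum_ffunE.
have hi := ltn_ord i.
case: ifP => h.
  rewrite (bigD1 (inord (m - i))) //= big1 => [|j].
    by rewrite !ffunE inordK ?ltnS // ifT ?addr0 //; lia.
  rewrite -val_eqE /= inordK ?ltnS // => ji.
  by rewrite !ffunE ifF ?scaler0 //; have := ltn_ord j; lia.
rewrite big1 // => j _; rewrite !ffunE ifF ?scaler0 //; have := ltn_ord j; lia.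
Qed.

Lemma kernel_term_in_ker k p (F : fps R (n - k).+1) d : (p < k <= n)%N ->
  kernel_term p F d \in lker (nabla_Mbar R m d).
Proof.
move=> pkn; apply/mem_lker_nabla_Mbar => i; have hi := ltn_ord i.
rewrite !kernel_termE // inordK; last by lia.
case: (leqP (m - i) p) => rp; last first.
  by rewrite linear0; case: ifP => h; [lia|rewrite mul0rn].
rewrite linearZ /= raising_Tseries; [|by lia..].
(* For [m - i < p] the equation is [Tcoef_rec]. For [m - i = p] the component is a multiple of
   T^p_{k,0}, killed by [raising], and the preceding component is zero or has the factor [i = 0]. *)
case: (ltnP (m - i) p) => rp'.
  case: (posnP i) => [|i0]; first by lia.
  rewrite ifT; last by lia.
  have -> : (m - i.-1 = (m - i).+1)%N by lia.
  have Eni : (i * (n - i) = i * (m - i).+1)%N by congr muln; lia.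
  have /(_ (m - i)%N) := @Tcoef_rec k p; rewrite (_ : m - (m - i) = i)%N; last by lia.
  rewrite -!scalerMnr -subnS !scalerMnl Eni => -> //; lia.
have -> : (p - (m - i) = 0)%N by lia.
rewrite mul0n mulr0n scaler0; case: ifP => h; last by rewrite mul0rn.
by have -> : (i = 0 :> nat)%N by lia.
Qed.

End Kernel.

(** * Polynomials of positive degree as sums of the functions T^p_{k,p} *)

Section Span.
Variables (R : realType) (m : nat).
Local Notation n := m.+1.

Lemma fps_lmul_linear v c (x : dhomog v R 1) (F G : fps R v) d :
  fps_lmul x (fun e => c *: F e + G e) d = c *: fps_lmul x F d + fps_lmul x G d.
Proof.
case: d => [|d] /=; first by rewrite scaler0 addr0.
by apply/val_inj; rewrite /= mulrDr -scalerAr.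
Qed.

Lemma Tseries_linear k j c (F G : fps R (n - k).+1) d :
  Tseries j (fun e => c *: F e + G e) d = c *: Tseries j F d + Tseries j G d.
Proof.
rewrite /Tseries; case: ifP => _; rewrite -fps_lmul_linear.
  by apply: fps_lmul_ext => // e; rewrite /fps_comp linearP.
apply: fps_lmul_ext => // e; rewrite -fps_lmul_linear.
by apply: fps_lmul_ext => // e'; rewrite /fps_comp linearP.
Qed.

Lemma Tseries_ext k j (F G : fps R (n - k).+1) d :
  (forall e, F e = G e) -> Tseries j F d = Tseries j G d.
Proof.
move=> FG; rewrite /Tseries; case: ifP => _; apply: fps_lmul_ext => // e.
  by rewrite /fps_comp FG.
by apply: fps_lmul_ext => // e'; rewrite /fps_comp FG.
Qed.

Lemma Tseries0 k j d : Tseries j ((fun e => 0) : fps R (n - k).+1) d = 0.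
Proof.
have := Tseries_linear j (-1) ((fun e => 0) : fps R (n - k).+1) (fun e => 0) d.
rewrite scaleN1r addNr => <-; apply: Tseries_ext => e.
by rewrite scaler0 addr0.
Qed.

Lemma TseriesZ k j c (F : fps R (n - k).+1) d :
  Tseries j (fun e => c *: F e) d = c *: Tseries j F d.
Proof.
rewrite -[RHS]addr0 -[X in _ = _ + X](Tseries0 k j d) -Tseries_linear.
by apply: Tseries_ext => e; rewrite addr0.
Qed.

(* The substitution x_{p+1+v} |-> y_v, a left inverse on the window
   [p, p + n - k] of the substitution in Tseries. *)
Definition window k p (i : 'I_n) : dhomog (n - k).+1 R 1 :=
  if (p <= i <= p + (n - k))%N then hvar R (inord (i - p)) else 0.

(** On the window the two substitutions compose to the identity, and a variable outside it has
    exponent 0. The default of [insubd] does not occur, as [mon] has degree [e]. *)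
Lemma hcomp_window k p e (mon : 'X_{1..n}) :
  mdeg mon = e -> (p < k <= n)%N ->
  (forall i : 'I_n, mon i != 0%N -> (p <= i <= p + (n - k))%N) ->
  val (hcomp (fun v : 'I_(n - k).+1 => xvar R m (p.+1 + v))
        (hcomp (window k p) (insubd (0 : dhomog n R e) 'X_[mon]))) = 'X_[mon].
Proof.
move=> dmon pkn supp.
have window_id i : mon i != 0%N ->
    hcomp (fun v : 'I_(n - k).+1 => xvar R m (p.+1 + v)) (window k p i) = hvar R i.
  move=> /supp hi; have lt_in := ltn_ord i.
  rewrite /window hi hcomp_hvar inordK; last by rewrite ltnS; lia.
  by congr hvar; apply/val_inj; rewrite /= inordK; lia.
rewrite hcomp_comp /= insubdK; last by rewrite [_ \in _]dhomogX /= dmon.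
rewrite comp_mpolyX [RHS]mpolyXE_id; apply: eq_bigr => i _.
case: (eqVneq (mon i) 0%N) => [-> //|nz]; congr (_ ^+ _).
rewrite tnth_mktuple; exact: (congr1 val (window_id i nz)).
Qed.

(** Splitting off one factor of the lowest and one of the highest variable leaves a monomial in the
    window between them. If the two coincide, only one factor is split off; this is the case k =
    n. *)
Lemma monomial_Tseries d (mon : 'X_{1..n}) : mdeg mon = d.+1 ->
  exists k p, exists2 F : fps R (n - k).+1,
    (p < k <= n)%N & val (Tseries p F d.+1) = 'X_[mon].
Proof.
move=> dmon.
have [i0 nz0] : exists i, mon i != 0%N.
  apply/existsP; apply: contraTT isT; rewrite negb_exists => /forallP h.
  have : mdeg mon = 0%N.
    by rewrite mdegE big1 // => i _; have := h i; rewrite negbK => /eqP.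
  by rewrite dmon.
case: (@arg_minnP _ i0 (fun i => mon i != 0%N) (fun i => i : nat) nz0) => lo nzlo lo_min.
case: (@arg_maxnP _ i0 (fun i => mon i != 0%N) (fun i => i : nat) nz0) => hi nzhi hi_max.
have hlo := ltn_ord lo; have hhi := ltn_ord hi; have lohi := lo_min _ nzhi.
(* Thus [n - k] is the distance between the extreme variables, and [p < k] amounts to [hi < n]. *)
pose k := (n - (hi - lo))%N; pose p := lo : nat.
have Ek : (n - k = hi - lo)%N by rewrite /k; lia.
have pkn : (p < k <= n)%N by rewrite /k /p; lia.
pose mon1 := (mon - U_(lo))%MM.
have Emon : mon = (U_(lo) + mon1)%MM by rewrite addmC submK // lep1mP.
have dmon1 : mdeg mon1 = d by move: dmon; rewrite {1}Emon mdegD mdeg1 add1n => -[].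
have supp1 i : mon1 i != 0%N -> (p <= i <= p + (n - k))%N.
  rewrite /mon1 mnmBE mnm1E => nzi.
  have nz : mon i != 0%N by move: nzi; lia.
  by have := lo_min _ nz; have := hi_max _ nz; rewrite Ek /p; lia.
exists k, p; case: (eqVneq lo hi) => [elh|nlh].
  have Ekn : k = n by rewrite /k elh; lia.
  (* In every degree but that of [mon1] the default makes the component zero, so the series is a
     single monomial. *)
  exists (fun e => hcomp (window k p) (insubd (0 : dhomog n R e) 'X_[mon1])) => //.
  rewrite /Tseries ifT; last by apply/eqP.
  rewrite /= /fps_comp.
  have /= -> := hcomp_window dmon1 pkn supp1.
  by rewrite [in RHS]Emon mpolyXD inord_val.
have nzhi1 : mon1 hi != 0%N.
  by rewrite /mon1 mnmBE mnm1E (negbTE nlh) subn0.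
pose mon2 := (mon1 - U_(hi))%MM.
have Emon1 : mon1 = (U_(hi) + mon2)%MM by rewrite addmC submK // lep1mP.
(* Two distinct variables occur, so the degree is at least 2. *)
case: d dmon dmon1 => [|d] dmon dmon1.
  by move: dmon1; rewrite Emon1 mdegD mdeg1.
have dmon2 : mdeg mon2 = d by move: dmon1; rewrite {1}Emon1 mdegD mdeg1 add1n => -[].
have supp2 i : mon2 i != 0%N -> (p <= i <= p + (n - k))%N.
  by rewrite /mon2 mnmBE => nzi; apply: supp1; move: nzi; lia.
exists (fun e => hcomp (window k p) (insubd (0 : dhomog n R e) 'X_[mon2])) => //.
rewrite /Tseries ifF; last first.
  by apply/eqP; move: nlh; rewrite -val_eqE /=; rewrite /k; lia.
rewrite /= /fps_comp.
have /= -> := hcomp_window dmon2 pkn supp2.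
rewrite [in RHS]Emon mpolyXD [in RHS]Emon1 mpolyXD inord_val.
congr (_ * (_ * _)); congr ('X_ _); apply/val_inj.
by rewrite /= Ek addnS /= inordK /p; lia.
Qed.

(** Up to a positive factor for each (k, p), this is both the last component of [kernel_form F] and
    its value under [corank_map]. *)
Definition Tsum (F : forall k p : nat, fps R (n - k).+1) d : dhomog n R d.+1 :=
  \sum_(1 <= k < n.+1) \sum_(0 <= p < k) Tseries p (F k p) d.+1.

Lemma Tsum_linear c F G d :
  Tsum (fun k p e => c *: F k p e + G k p e) d = c *: Tsum F d + Tsum G d.
Proof.
rewrite /Tsum scaler_sumr -big_split; apply: eq_bigr => k _ /=.
rewrite scaler_sumr -big_split; apply: eq_bigr => p _ /=.
exact: Tseries_linear.
Qed.

Lemma Tsum0 d : Tsum (fun k p e => 0) d = 0.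
Proof. by rewrite /Tsum !big1 // => k _; rewrite big1 // => p _; rewrite Tseries0. Qed.

Lemma Tsum_surj d (q : dhomog n R d.+1) : exists F, Tsum F d = q.
Proof.
have mono k0 p0 (F : fps R (n - k0).+1) : (p0 < k0 <= n)%N ->
    exists G, Tsum G d = Tseries p0 F d.+1.
  move=> pkn.
  (* The family is [F] at [(k0, p0)] and zero elsewhere; the cast is there because the number of
     variables depends on [k]. *)
  pose G k p : fps R (n - k).+1 := fun e =>
    match k0 =P k with
    | ReflectT E => if p == p0 then
        ecast k (dhomog (n - k).+1 R e) E (F e) else 0
    | ReflectF _ => 0
    end.
  exists G; rewrite /Tsum (bigD1_seq k0) ?iota_uniq ?mem_index_iota //=; last by lia.
  rewrite [X in _ + X]big1 ?addr0 => [|k nk].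
    rewrite (bigD1_seq p0) ?iota_uniq ?mem_index_iota //=; last by lia.
    rewrite big1 ?addr0 => [|p np].
      apply: Tseries_ext => e; rewrite /G eqxx; case: eqP => // E.
      by rewrite (eq_axiomK E).
    rewrite -[RHS](Tseries0 k0 p d.+1); apply: Tseries_ext => e; rewrite /G (negbTE np).
    by case: eqP.
  rewrite big1 // => p _.
  rewrite -[RHS](Tseries0 k p d.+1); apply: Tseries_ext => e; rewrite /G.
  by case: eqP => // E; rewrite E eqxx in nk.
have -> : q = \sum_(mon <- msupp (val q))
    (val q)@_mon *: insubd (0 : dhomog n R d.+1) 'X_[mon].
  apply/val_inj; rewrite /= raddf_sum [LHS]mpolyE big_seq [RHS]big_seq.
  apply: eq_bigr => mon hmon /=.
  rewrite insubdK // [_ \in _]dhomogX.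
  by rewrite (dhomog_mf (valP q) hmon).
rewrite big_seq; elim/big_ind: _ => [|x y [F <-] [G <-]|mon hmon].
- by exists (fun k p e => 0); apply: Tsum0.
- exists (fun k p e => 1 *: F k p e + G k p e).
  by rewrite Tsum_linear scale1r.
have dmon : mdeg mon = d.+1 by apply: (dhomog_mf (valP q) hmon).
have [k [p [F pkn EF]]] := monomial_Tseries dmon.
have [G EG] := mono k p F pkn.
(* The summand [0] gives the scalar multiple the shape of [Tsum_linear]. *)
exists (fun k p e => (val q)@_mon *: G k p e + 0).
rewrite (Tsum_linear _ _ (fun k p e => 0)) Tsum0 addr0 EG; congr (_ *: _).
apply/val_inj; rewrite insubdK ?EF //.
by rewrite [_ \in _]dhomogX /= dmon.
Qed.

End Span.

(** * The image of nabla_N, and its complement *)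

Section Complement.
Variables (R : realType) (m : nat).
Local Notation n := m.+1.

(** A polynomial of positive degree is a sum of chain elements, and each chain has length k <= n. *)
Lemma iter_shift_up_nilpotent d (q : dhomog n R d.+1) :
  iter n (@shift_up R m d.+1) q = 0.
Proof.
have [F <-] := Tsum_surj q.
rewrite /Tsum iter_raddf_sum big_nat big1 // => k kn.
rewrite iter_raddf_sum big_nat big1 // => p pk.
rewrite (@chain_iter_up _ _ k (fun j => Tseries j (F k p) d.+1)).
- by rewrite ifF //; lia.
- exact: linear0.
- by move=> j jk; apply: shift_up_Tseries; lia.
- by lia.
Qed.

(* Modulo im nabla_N, a vector field is equivalent to this polynomial times e_n. *)
Definition corank_fun d (phi : 'P^n[R]_d) : dhomog n R d.+1 :=
  \sum_(i < n) iter (m - i) (@shift_up R m d.+1) (phi i).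

Lemma corank_fun_is_linear d : linear (@corank_fun d).
Proof.
move=> c f g; rewrite /corank_fun scaler_sumr -big_split /=.
apply: eq_bigr => i _; rewrite !ffunE iter_linear //; exact: hcomp_is_linear.
Qed.

HB.instance Definition _ d :=
  GRing.isLinear.Build R 'P^n[R]_d (dhomog n R d.+1) _ (@corank_fun d)
    (@corank_fun_is_linear d).

Definition corank_map d : 'Hom('P^n[R]_d, dhomog n R d.+1) :=
  linfun (@corank_fun d).

(** The equations are psi_{i+1} - N_* psi_i = phi_i, with indices from 0 and psi_n = 0. Applying
    N_*^{m-i} and summing telescopes to -N_*^n psi_0 = 0. *)
Lemma limg_nabla_jordanN d :
  (limg (nabla d (jordanN R m)) = lker (corank_map d))%VS.
Proof.
apply/vspaceP => phi; apply/idP/idP.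
  case/memv_imgP => psi _ ->; rewrite memv_ker lfunE /= /corank_fun.
  have E (i : 'I_n) :
      iter (m - i) (@shift_up R m d.+1) (nabla d (jordanN R m) psi i) =
      (if (i.+1 < n)%N then iter (n - i.+1) (@shift_up R m d.+1) (psi (inord i.+1))
       else 0) - iter (n - i) (@shift_up R m d.+1) (psi (inord i)).
    rewrite nabla_jordanNE iter_raddfB.
    apply: (congr2 (fun x y => x - y)); last first.
      have -> : (n - i = (m - i).+1)%N by have := ltn_ord i; lia.
      rewrite inord_val; exact: esym (iterSr _ _ _).
    case: ifP => _; [by rewrite subSS|apply: iter_fixed0; exact: linear0].
  pose g (i : nat) : dhomog n R d.+1 :=
    if (i < n)%N then iter (n - i) (@shift_up R m d.+1) (psi (inord i)) else 0.
  apply/eqP; transitivity (\sum_(0 <= i < n) (g i.+1 - g i)).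
    by rewrite big_mkord; apply: eq_bigr => i _; rewrite E /g ltn_ord.
  rewrite telescope_sumr // /g ltnn sub0r subn0.
  by rewrite iter_shift_up_nilpotent oppr0.
rewrite memv_ker lfunE /= => /eqP phi0.
(* Conversely the equations are solved upwards from psi_0 = 0; the end condition [g n = 0] is
   exactly the vanishing of [corank_fun]. *)
pose g := fix g (i : nat) : dhomog n R d.+1 :=
  if i is i'.+1 then phi (inord i') + shift_up (g i') else 0.
have gE i : g i = \sum_(t < i) iter (i.-1 - t) (@shift_up R m d.+1) (phi (inord t)).
  elim: i => [|i IH] /=; first by rewrite big_ord0.
  rewrite big_ord_recr /= subnn addrC IH raddf_sum; congr (_ + _).
  apply: eq_bigr => t _; have -> : (i - t = (i.-1 - t).+1)%N by have := ltn_ord t; lia.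
  by rewrite iterS.
have gn : g n = 0.
  rewrite gE -[RHS]phi0 /corank_fun; apply: eq_bigr => t _.
  by rewrite inord_val.
apply/memv_imgP; exists [ffun i : 'I_n => g i]; first exact: memvf.
apply/ffunP => i; rewrite nabla_jordanNE !ffunE.
have Eg : phi i = g i.+1 - shift_up (g i) by rewrite /= inord_val addrK.
case: ifP => h; first by rewrite inordK.
rewrite Eg (_ : i.+1 = n) ?gn //; have := ltn_ord i; lia.
Qed.

Definition kernel_weight k p : R := \sum_(i < p.+1) Tcoef R m k p i (p - i).

Lemma Tcoef_gt0 k p i : (k <= n)%N -> (p < k)%N -> (i <= p)%N ->
  0 < Tcoef R m k p i (p - i).
Proof.
move=> kn pk ip; rewrite /Tcoef mulr_gt0 ?divr_gt0 ?ltr0n ?muln_gt0 ?fact_gt0 //.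
  by rewrite bin_gt0.
by rewrite !bin_gt0; lia.
Qed.

Lemma kernel_weight_gt0 k p : (k <= n)%N -> (p < k)%N -> 0 < kernel_weight k p.
Proof.
move=> kn pk; have pos (i : 'I_p.+1) := Tcoef_gt0 kn pk (leq_ord i).
rewrite /kernel_weight (bigD1 ord0) //= ltr_pwDl //; first exact: (pos ord0).
by apply: sumr_ge0 => i _; exact: ltW (pos i).
Qed.

(** The component at e_{n-i} is a multiple of T^p_{k,p-i} and is shifted up i times, so all summands
    land on T^p_{k,p}. *)
Lemma corank_kernel_term k p (F : fps R (n - k).+1) d : (p < k <= n)%N ->
  corank_map d (kernel_term p F d) = kernel_weight k p *: Tseries p F d.+1.
Proof.
move=> pkn; rewrite lfunE /= /kernel_term linear_sum /= /kernel_weight scaler_suml.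
apply: eq_bigr => i _; rewrite linearZ /=; congr (_ *: _).
have hi := ltn_ord i.
rewrite /corank_fun (bigD1 (inord (m - i))) //= big1 ?addr0 => [|j].
  rewrite ffunE inordK; last by lia.
  rewrite ifT; last by lia.
  rewrite (_ : m - (m - i) = i)%N; last by lia.
  by rewrite iter_shift_up_Tseries ?subnK //; lia.
rewrite -val_eqE /= inordK => [ji|]; last by lia.
rewrite ffunE ifF; last by have := ltn_ord j; lia.
by rewrite iter_fixed0 // linear0.
Qed.

Lemma kernel_formE (F : forall k p : nat, fps R (n - k).+1) d :
  kernel_form F d =
  \sum_(1 <= k < n.+1) \sum_(0 <= p < k) kernel_term p (F k p) d.
Proof. by []. Qed.

Lemma kernel_form_in_ker (F : forall k p : nat, fps R (n - k).+1) d :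
  kernel_form F d \in lker (nabla_Mbar R m d).
Proof.
rewrite kernel_formE big_nat; apply: memv_suml => k kn.
rewrite big_nat; apply: memv_suml => p pk.
by apply: kernel_term_in_ker; lia.
Qed.

Lemma corank_kernel_surj d (q : dhomog n R d.+1) :
  exists F : forall k p : nat, fps R (n - k).+1, corank_map d (kernel_form F d) = q.
Proof.
have [F <-] := Tsum_surj q.
exists (fun k p e => (kernel_weight k p)^-1 *: F k p e).
rewrite kernel_formE linear_sum /Tsum big_nat [RHS]big_nat; apply: eq_bigr => k kn.
rewrite linear_sum big_nat [RHS]big_nat; apply: eq_bigr => p pk.
rewrite /= corank_kernel_term; last by lia.
rewrite TseriesZ scalerA mulfV ?scale1r // gt_eqF // kernel_weight_gt0 //; lia.
Qed.

Lemma kernel_form_last d (q : dhomog n R d.+1) :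
  exists F : forall k p : nat, fps R (n - k).+1, kernel_form F d ord_max = q.
Proof.
have [F <-] := Tsum_surj q.
(* Only the term with i = 0 reaches e_n, and its coefficient is cancelled here. *)
exists (fun k p e => (Tcoef R m k p 0 p)^-1 *: F k p e).
rewrite kernel_formE sum_ffunE /Tsum big_nat [RHS]big_nat; apply: eq_bigr => k kn.
rewrite sum_ffunE big_nat [RHS]big_nat; apply: eq_bigr => p pk.
rewrite kernel_termE; last by lia.
rewrite /= subnn subn0 TseriesZ scalerA mulfV ?scale1r // gt_eqF //.
by have := @Tcoef_gt0 k p 0; rewrite subn0; apply => //; lia.
Qed.

(** The recurrence is solved downwards from e_n: the factor [i * (n - i)] is nonzero for
    [0 < i < n]. *)
Lemma ker_nabla_Mbar_last0 d (phi : 'P^n[R]_d) :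
  phi \in lker (nabla_Mbar R m d) -> phi ord_max = 0 -> phi = 0.
Proof.
move/mem_lker_nabla_Mbar => kphi last0.
have H r : (r <= m)%N -> phi (inord (m - r)) = 0.
  elim: r => [|r IH] rm.
    by rewrite subn0 -[RHS]last0; congr (phi _); apply/val_inj; rewrite /= inordK.
  have := kphi (inord (m - r)); rewrite IH; last by lia.
  rewrite linear0 inordK; last by lia.
  rewrite -subnS -scaler_nat => /eqP; rewrite scaler_eq0 pnatr_eq0 => /orP[|/eqP//].
  by rewrite muln_eq0; lia.
apply/ffunP => i; rewrite ffunE -(H (m - i)%N) ?leq_subr //.
by congr (phi _); apply/val_inj; have := ltn_ord i; rewrite /= inordK; lia.
Qed.

Definition last_component d (phi : 'P^n[R]_d) : dhomog n R d.+1 := phi ord_max.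

Lemma last_component_is_linear d : linear (@last_component d).
Proof. by move=> c f g; rewrite /last_component !ffunE. Qed.

HB.instance Definition _ d :=
  GRing.isLinear.Build R 'P^n[R]_d (dhomog n R d.+1) _ (@last_component d)
    (@last_component_is_linear d).

Lemma complement_im_ker d :
  complement (limg (nabla d (jordanN R m))) (lker (nabla_Mbar R m d)).
Proof.
rewrite limg_nabla_jordanN; split.
  apply/vspaceP => phi; rewrite memvf.
  (* Subtracting a kernel form with the same value under [corank_map] leaves an element of the
     image. *)
  have [F EF] := corank_kernel_surj (corank_map d phi).
  rewrite -(subrK (kernel_form F d) phi); apply: memv_add.
    by rewrite memv_ker linearB /= EF subrr.
  exact: kernel_form_in_ker.
set K := lker (nabla_Mbar R m d).
(* The last component is injective on [K]. *)
have leK : (\dim K <= \dim {: dhomog n R d.+1})%N.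
  rewrite -(@limg_dim_eq _ _ _ (linfun (@last_component d)) K).
    exact: dimvS (subvf _).
  apply/eqP; rewrite -subv0; apply/subvP => phi; rewrite memv_cap => /andP[kphi].
  rewrite memv_ker lfunE /= => /eqP l0.
  by rewrite (ker_nabla_Mbar_last0 kphi l0) mem0v.
have fullK : (corank_map d @: K = fullv)%VS.
  apply/vspaceP => q; rewrite memvf; have [F <-] := corank_kernel_surj q.
  by apply: memv_img; apply: kernel_form_in_ker.
(* As [corank_map] sends [K] onto a space of at least its dimension, rank-nullity makes its kernel
   in [K] trivial. *)
apply/eqP; rewrite -dimv_eq0 capvC.
rewrite -leqn0 -(leq_add2r (\dim {: dhomog n R d.+1})) add0n.
by have := limg_ker_dim (corank_map d) K; rewrite fullK => ->.
Qed.

(* T^p_{k,j} takes its component of degree d + 1 from the component of F of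
   degree d if k = n, and of degree d - 1 otherwise. *)
Lemma kernel_form_at_degree (F : nat -> forall k p : nat, fps R (n - k).+1) d :
  kernel_form (fun k p e => F (if k == n then e else e.+1) k p e) d =
  kernel_form (F d) d.
Proof.
rewrite !kernel_formE; apply: eq_bigr => k _; apply: eq_bigr => p _.
apply: eq_bigr => i _; congr (_ *: _); apply/ffunP => s; rewrite !ffunE.
case: ifP => // _; rewrite /Tseries; case: ifP => kn /=.
  by rewrite /fps_comp kn.
by case: d => [|d]; rewrite // /fps_lmul /fps_comp kn.
Qed.

Lemma ker_nabla_Mbar_form d (phi : 'P^n[R]_d) :
  phi \in lker (nabla_Mbar R m d) ->
  exists F : forall k p : nat, fps R (n - k).+1, phi = kernel_form F d.
Proof.
move=> kphi; have [F EF] := kernel_form_last (phi ord_max).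
exists F; apply/subr0_eq/ker_nabla_Mbar_last0.
  by rewrite rpredB // kernel_form_in_ker.
by rewrite !ffunE EF subrr.
Qed.

Lemma ker_nabla_Mbar_char (phi : formal_map R m) :
  (forall d, phi d \in lker (nabla_Mbar R m d)) <->
  exists F : forall k p : nat, fps R (n - k).+1, forall d, phi d = kernel_form F d.
Proof.
split=> [kphi|[F EF] d]; last by rewrite EF kernel_form_in_ker.
have [F EF] := choice (fun d => ker_nabla_Mbar_form (kphi d)).
(* The component of degree [e] of a series enters only one degree of the map, so the series chosen
   degree by degree combine into one family. *)
exists (fun k p e => F (if k == n then e else e.+1) k p e) => d.
by rewrite kernel_form_at_degree.
Qed.

End Complement.

(** * Complement, kernel and normal form together *)

Theorem mainTheorem4 (R : realType) (m : nat) :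
  [/\ forall k : nat,
        complement (limg (nabla k (jordanN R m))) (lker (nabla_Mbar R m k)),
      forall phi : formal_map R m,
        (forall k : nat, phi k \in lker (nabla_Mbar R m k)) <->
        exists F : forall k p : nat, fps R (m.+1 - k).+1,
          forall d : nat, phi d = kernel_form F d
    & forall f : formal_map R m,
        normal_form (jordanN R m) (fun k => lker (nabla_Mbar R m k)) f <->
        exists F : forall k p : nat, fps R (m.+1 - k).+1,
          kernel_form F 0%N = 0 /\
          forall d : nat, f d = linear_part (jordanN R m) d + kernel_form F d].
Proof.
split=> [k|phi|f]; [exact: complement_im_ker|exact: ker_nabla_Mbar_char|].
split=> [[f0 fS]|[F [F0 EF]]].
  (* The linear term is replaced by zero, so that the resulting kernel form is purely nonlinear. *)
  pose phi : formal_map R m := fun d => if d is 0 then 0 else f d.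
  have [|F EF] := (ker_nabla_Mbar_char phi).1.
    by case=> [|d]; rewrite ?mem0v //; case: (fS d.+1 isT).
  exists F; split; first by rewrite -EF.
  by case=> [|d]; rewrite -EF /= ?addr0 ?add0r.
split; first by rewrite EF F0 addr0.
move=> [//|d] _; split; first exact: complement_im_ker.
by rewrite EF /= add0r kernel_form_in_ker.
Qed.
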